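(* Every non-reflexive right $M$-embedded operator space $X$ has the unique extension property: the only completely contractive linear operator $T:X^{**}\to X^{**}$ whose restriction to $X$ is the identity (that is, $T\circ i_X=i_X$) is $\mathrm{Id}_{X^{**}}$.
   Context: For an operator space $X$, the bidual $X^{**}$ carries its standard dual operator space structure and $i_X:X\to X^{**}$ is the canonical complete isometry. $C_2(X)$ denotes the space of columns of length 2 over $X$, as a subspace of $M_2(X)$. A complete left $M$-projection on an operator space $X$ is a linear idempotent $P:X\to X$ such that the map $X\to C_2(X)$, $x\mapsto \begin{bmatrix}P(x)\\ x-P(x)\end{bmatrix}$, is a complete isometry. A right $M$-summand is the range of a complete left $M$-projection. A closed subspace $J\subset X$ is a right $M$-ideal of $X$ if $J^{\perp\perp}$ is a right $M$-summand of $X^{**}$. An operator space $X$ is right $M$-embedded if $i_X(X)$ is a right $M$-ideal of $X^{**}$. *)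

(* Defs.v *)
From HB Require Import structures.
From mathcomp Require Import all_boot all_order all_algebra complex ring lra.
From mathcomp Require Import mathcomp_extra boolp classical_sets functions reals.
From mathcomp Require Import topology normedtype.

Set Implicit Arguments.
Unset Strict Implicit.
Unset Printing Implicit Defensive.

Import Order.TTheory GRing.Theory Num.Theory.
Import numFieldNormedType.Exports.

Local Open Scope classical_set_scope.
Local Open Scope complex_scope.
Local Open Scope ring_scope.

(* The modulus with values in R; the norm of R[i] takes its values in R[i]. *)
Definition cabs (R : realType) (z : R[i]) : R := ComplexField.Normc.normc z.

(* The Hilbert space norm of C^n; the library norm on matrices is the max norm. *)
Definition hnorm (R : realType) (n : nat) (v : 'cV[R[i]]_n) : R :=
  Num.sqrt (\sum_i cabs (v i 0) ^+ 2).

(* Norm of A as an operator between Hilbert spaces; see opnorm_has_sup. *)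
Definition opnorm (R : realType) (m n : nat) (A : 'M[R[i]]_(m, n)) : R :=
  sup [set hnorm (A *m v) | v in [set v : 'cV[R[i]]_n | hnorm v <= 1]].

(* The scalar bimodule action a x b on matrices over a complex vector space. *)
Definition mxact (R : realType) (X : lmodType R[i]) (p m n q : nat)
    (a : 'M[R[i]]_(p, m)) (x : 'M[X]_(m, n)) (b : 'M[R[i]]_(n, q)) :
    'M[X]_(p, q) :=
  \matrix_(i, j) \sum_k \sum_l (a i k * b l j) *: x k l.

Section opnorm_theory.
Context (R : realType).
Implicit Types (m n p : nat) (z : R[i]).

Lemma normcE z : `|z| = (cabs z)%:C. Proof. by []. Qed.

Lemma cabs_ge0 z : 0 <= cabs z.
Proof. by case: z => a b; exact: sqrtr_ge0. Qed.

Lemma cabs0 : cabs (0 : R[i]) = 0. Proof. exact: ComplexField.Normc.normc0. Qed.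

Lemma cabs0_eq0 z : cabs z = 0 -> z = 0.
Proof. exact: ComplexField.Normc.eq0_normc. Qed.

Lemma cabsM y z : cabs (y * z) = cabs y * cabs z.
Proof. exact: ComplexField.Normc.normcM. Qed.

Lemma cabsC (r : R) : cabs r%:C = `|r|.
Proof. by rewrite /cabs/= expr0n/= addr0 sqrtr_sqr. Qed.

Lemma cabsD y z : cabs (y + z) <= cabs y + cabs z.
Proof. by rewrite -lecR rmorphD -!normcE ler_normD. Qed.

Lemma cabs_sum (I : finType) (F : I -> R[i]) :
  cabs (\sum_i F i) <= \sum_i cabs (F i).
Proof.
elim/big_rec2: _ => [|i y z _ h]; first by rewrite cabs0.
by rewrite (le_trans (cabsD _ _))// lerD2l.
Qed.

Lemma CauchySchwarz_sum (I : finType) (a b : I -> R) :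
  (\sum_i a i * b i) ^+ 2 <= (\sum_i a i ^+ 2) * (\sum_i b i ^+ 2).
Proof.
rewrite -subr_ge0 -(pmulr_rge0 _ (ltr0Sn R 1)).
suff -> : 2 * ((\sum_i a i ^+ 2) * (\sum_i b i ^+ 2) - (\sum_i a i * b i) ^+ 2) =
    \sum_i \sum_j (a i * b j - a j * b i) ^+ 2.
  by do 2!apply: sumr_ge0 => ? _; exact: sqr_ge0.
have E : (\sum_i a i ^+ 2) * (\sum_i b i ^+ 2) =
   \sum_i \sum_j a i ^+ 2 * b j ^+ 2.
  by rewrite big_distrl; apply: eq_bigr => i _; rewrite big_distrr.
have E' : (\sum_i a i * b i) ^+ 2 = \sum_i \sum_j (a i * b i) * (a j * b j).
  by rewrite expr2 big_distrl; apply: eq_bigr => i _; rewrite big_distrr.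
transitivity (\sum_i \sum_j a i ^+ 2 * b j ^+ 2 +
  \sum_i \sum_j a j ^+ 2 * b i ^+ 2 -
  2 * \sum_i \sum_j (a i * b i) * (a j * b j)).
  by rewrite [X in _ + X - _]exchange_big/= -E -E'; ring.
rewrite mulr_sumr -big_split -sumrB/=; apply: eq_bigr => i _.
rewrite mulr_sumr -big_split -sumrB/=; apply: eq_bigr => j _.
by ring.
Qed.

Lemma Minkowski_sum (I : finType) (a b : I -> R) :
  (forall i, 0 <= a i) -> (forall i, 0 <= b i) ->
  Num.sqrt (\sum_i (a i + b i) ^+ 2) <=
  Num.sqrt (\sum_i a i ^+ 2) + Num.sqrt (\sum_i b i ^+ 2).
Proof.
move=> a0 b0.
have sq (c : I -> R) : 0 <= \sum_i c i ^+ 2.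
  by apply: sumr_ge0 => i _; exact: sqr_ge0.
rewrite -[leRHS]ger0_norm ?addr_ge0 ?sqrtr_ge0// -sqrtr_sqr ler_wsqrtr//.
rewrite sqrrD !sqr_sqrtr//.
have -> : \sum_i (a i + b i) ^+ 2 =
    \sum_i a i ^+ 2 + (\sum_i a i * b i) *+ 2 + \sum_i b i ^+ 2.
  by rewrite -sumrMnl -!big_split/=; apply: eq_bigr => i _; rewrite sqrrD.
rewrite lerD2r lerD2l lerMn2r/= -sqrtrM//.
rewrite -[leLHS]ger0_norm; last by apply: sumr_ge0 => i _; rewrite mulr_ge0.
by rewrite -sqrtr_sqr ler_wsqrtr// CauchySchwarz_sum.
Qed.

Lemma hnorm_ge0 n (v : 'cV[R[i]]_n) : 0 <= hnorm v.
Proof. exact: sqrtr_ge0. Qed.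

Lemma hnorm_sqr n (v : 'cV[R[i]]_n) : hnorm v ^+ 2 = \sum_i cabs (v i 0) ^+ 2.
Proof. by rewrite sqr_sqrtr// sumr_ge0// => i _; exact: sqr_ge0. Qed.

Lemma hnorm_le n (v : 'cV[R[i]]_n) (M : R) : 0 <= M ->
  \sum_i cabs (v i 0) ^+ 2 <= M ^+ 2 -> hnorm v <= M.
Proof. by move=> M0; rewrite -hnorm_sqr ler_pXn2r// nnegrE hnorm_ge0. Qed.

Lemma hnormD n (u v : 'cV[R[i]]_n) : hnorm (u + v) <= hnorm u + hnorm v.
Proof.
apply: le_trans (Minkowski_sum (fun i => cabs_ge0 (u i 0))
  (fun i => cabs_ge0 (v i 0))).
apply: ler_wsqrtr; apply: ler_sum => i _.
by rewrite mxE ler_pXn2r ?nnegrE ?addr_ge0 ?cabs_ge0// cabsD.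
Qed.

Lemma hnormZ n (c : R[i]) (v : 'cV[R[i]]_n) : hnorm (c *: v) = cabs c * hnorm v.
Proof.
rewrite /hnorm -[cabs c]ger0_norm ?cabs_ge0// -sqrtr_sqr -sqrtrM ?sqr_ge0//.
congr Num.sqrt; rewrite big_distrr/=; apply: eq_bigr => i _.
by rewrite mxE cabsM exprMn.
Qed.

Lemma hnorm0 n : hnorm (0 : 'cV[R[i]]_n) = 0.
Proof. by rewrite -(scale0r 0) hnormZ cabs0 mul0r. Qed.

Lemma cabs_le_hnorm n (v : 'cV[R[i]]_n) i : cabs (v i 0) <= hnorm v.
Proof.
rewrite -[leLHS]ger0_norm ?cabs_ge0// -sqrtr_sqr ler_wsqrtr//.
by rewrite (bigD1 i)//= lerDl sumr_ge0// => j _; exact: sqr_ge0.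
Qed.

Lemma hnorm0_eq0 n (v : 'cV[R[i]]_n) : hnorm v = 0 -> v = 0.
Proof.
move=> v0; apply/matrixP => i j; rewrite ord1 mxE; apply: cabs0_eq0.
by apply/eqP; rewrite eq_le cabs_ge0 -v0 cabs_le_hnorm.
Qed.

Lemma hnorm_le_sum n (v : 'cV[R[i]]_n) : hnorm v <= \sum_i cabs (v i 0).
Proof.
apply: hnorm_le; first by apply: sumr_ge0 => i _; exact: cabs_ge0.
rewrite [leRHS]expr2 big_distrl/=; apply: ler_sum => i _.
rewrite expr2 ler_wpM2l ?cabs_ge0// (bigD1 i)//= lerDl sumr_ge0// => j _.
exact: cabs_ge0.
Qed.

Lemma opnorm_has_sup m n (A : 'M[R[i]]_(m, n)) :
  has_sup [set hnorm (A *m v) | v in [set v : 'cV[R[i]]_n | hnorm v <= 1]].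
Proof.
split; first by exists (hnorm (A *m 0)), 0; rewrite //= hnorm0 ler01.
exists (\sum_i \sum_j cabs (A i j)) => _ [v /= v1 <-].
apply: le_trans (hnorm_le_sum _) _; apply: ler_sum => i _.
rewrite mxE; apply: le_trans (cabs_sum _) _; apply: ler_sum => j _.
rewrite cabsM ler_piMr ?cabs_ge0//.
exact: le_trans (cabs_le_hnorm _ _) v1.
Qed.

Lemma opnorm_ge0 m n (A : 'M[R[i]]_(m, n)) : 0 <= opnorm A.
Proof.
apply: le_trans (hnorm_ge0 (A *m 0)) _.
apply: (ub_le_sup (opnorm_has_sup A).2).
by exists 0; rewrite //= hnorm0 ler01.
Qed.

Lemma opnorm_ub m n (A : 'M[R[i]]_(m, n)) v :
  hnorm (A *m v) <= opnorm A * hnorm v.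
Proof.
have [/hnorm0_eq0 ->|v0] := eqVneq (hnorm v) 0.
  by rewrite mulmx0 !hnorm0 mulr0.
have vp : 0 < hnorm v by rewrite lt_neqAle eq_sym v0 hnorm_ge0.
rewrite -ler_pdivrMr//.
have E : cabs (hnorm v)^-1%:C = (hnorm v)^-1.
  by rewrite cabsC ger0_norm// invr_ge0 hnorm_ge0.
apply: (ub_le_sup (opnorm_has_sup A).2).
exists ((hnorm v)^-1%:C *: v) => /=; first by rewrite hnormZ E mulVf.
by rewrite -scalemxAr hnormZ E mulrC.
Qed.

Lemma opnorm_le m n (A : 'M[R[i]]_(m, n)) (M : R) : 0 <= M ->
  (forall v, hnorm (A *m v) <= M * hnorm v) -> opnorm A <= M.
Proof.
move=> M0 AM; apply: ge_sup; first exact: (opnorm_has_sup A).1.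
by move=> _ [v /= v1 <-]; rewrite (le_trans (AM v))// ler_piMr.
Qed.

Lemma opnorm0 m n : opnorm (0 : 'M[R[i]]_(m, n)) = 0.
Proof.
apply/eqP; rewrite eq_le opnorm_ge0 andbT; apply: opnorm_le => // v.
by rewrite mul0mx hnorm0 mul0r.
Qed.

Lemma opnormD m n (A B : 'M[R[i]]_(m, n)) :
  opnorm (A + B) <= opnorm A + opnorm B.
Proof.
apply: opnorm_le; first by rewrite addr_ge0 ?opnorm_ge0.
move=> v; rewrite mulmxDl (le_trans (hnormD _ _))// mulrDl.
by rewrite lerD ?opnorm_ub.
Qed.

Lemma opnorm_sum m n (I : finType) (F : I -> 'M[R[i]]_(m, n)) :
  opnorm (\sum_i F i) <= \sum_i opnorm (F i).
Proof.
elim/big_rec2: _ => [|i y z _ h]; first by rewrite opnorm0.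
by rewrite (le_trans (opnormD _ _))// lerD2l.
Qed.

Lemma opnormM m n p (A : 'M[R[i]]_(m, n)) (B : 'M[R[i]]_(n, p)) :
  opnorm (A *m B) <= opnorm A * opnorm B.
Proof.
apply: opnorm_le; first by rewrite mulr_ge0 ?opnorm_ge0.
move=> v; rewrite -mulmxA (le_trans (opnorm_ub _ _))// -mulrA.
by rewrite ler_wpM2l ?opnorm_ge0 ?opnorm_ub.
Qed.

Lemma opnormZ m n (c : R[i]) (A : 'M[R[i]]_(m, n)) :
  opnorm (c *: A) = cabs c * opnorm A.
Proof.
have h d (B : 'M[R[i]]_(m, n)) : opnorm (d *: B) <= cabs d * opnorm B.
  apply: opnorm_le; first by rewrite mulr_ge0 ?cabs_ge0 ?opnorm_ge0.
  move=> v; rewrite -scalemxAl hnormZ -mulrA ler_wpM2l ?cabs_ge0//.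
  exact: opnorm_ub.
apply/eqP; rewrite eq_le h/=; have [->|c0] := eqVneq c 0.
  by rewrite cabs0 mul0r opnorm_ge0.
have cp : 0 < cabs c.
  rewrite lt_neqAle cabs_ge0 andbT eq_sym; apply: contra c0 => /eqP.
  by move/cabs0_eq0 ->.
have := h c^-1 (c *: A); rewrite scalerA mulVf// scale1r.
rewrite -(ler_pM2l cp) mulrA -cabsM mulfV// => /le_trans; apply.
by rewrite cabsC normr1 mul1r.
Qed.

Lemma cabs_le_opnorm m n (A : 'M[R[i]]_(m, n)) i j : cabs (A i j) <= opnorm A.
Proof.
have e1 : hnorm (delta_mx j 0 : 'cV[R[i]]_n) <= 1.
  apply: hnorm_le => //; rewrite (bigD1 j)//= big1 ?addr0.
    by rewrite mxE !eqxx cabsC normr1.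
  by move=> k /negPf kj; rewrite mxE kj cabs0 expr0n.
have -> : A i j = (A *m (delta_mx j 0 : 'cV[R[i]]_n)) i 0.
  rewrite mxE (bigD1 j)//= mxE !eqxx mulr1 big1 ?addr0// => k /negPf kj.
  by rewrite mxE kj mulr0.
apply: le_trans (cabs_le_hnorm _ _) _; apply: le_trans (opnorm_ub _ _) _.
by rewrite ler_piMr ?opnorm_ge0.
Qed.

Lemma opnorm_col n (v : 'cV[R[i]]_n) : opnorm v <= hnorm v.
Proof.
apply: opnorm_le => [|u]; first exact: hnorm_ge0.
have -> : v *m u = u 0 0 *: v.
  by apply/matrixP => i j; rewrite (ord1 j) !mxE big_ord1 mulrC.
by rewrite hnormZ mulrC ler_wpM2l ?hnorm_ge0 ?cabs_le_hnorm.
Qed.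

Lemma cabs_conj z : cabs z^*%C = cabs z.
Proof. by case: z => a b; rewrite /cabs/= sqrrN. Qed.

Lemma mulc_conj z : z^*%C * z = (cabs z ^+ 2)%:C.
Proof.
case: z => a b; rewrite /cabs/= sqr_sqrtr ?addr_ge0 ?sqr_ge0//.
by apply/eqP; rewrite eq_complex/=; apply/andP; split; apply/eqP; ring.
Qed.

Lemma opnorm_adj n (v : 'cV[R[i]]_n) :
  opnorm (\row_j (v j 0)^*%C) <= hnorm v.
Proof.
apply: opnorm_le => [|u]; first exact: hnorm_ge0.
apply: hnorm_le; first by rewrite mulr_ge0 ?hnorm_ge0.
rewrite big_ord1 exprMn !hnorm_sqr mxE.
apply: le_trans (CauchySchwarz_sum _ _).
rewrite ler_pXn2r ?nnegrE ?cabs_ge0//; last first.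
  by apply: sumr_ge0 => i _; rewrite mulr_ge0 ?cabs_ge0.
apply: le_trans (cabs_sum _) _; apply: ler_sum => j _.
by rewrite mxE cabsM cabs_conj.
Qed.

Lemma hnorm_sqr_adj n (v : 'cV[R[i]]_n) :
  (hnorm v ^+ 2)%:C = \sum_i (v i 0)^*%C * v i 0.
Proof.
by rewrite hnorm_sqr rmorph_sum/=; apply: eq_bigr => i _; rewrite mulc_conj.
Qed.

Lemma sum_Rank (m : nat) (p_ : 'I_m -> nat) (F : 'I_(\sum_i p_ i) -> R) :
  \sum_s F s = \sum_i \sum_j F (tagnat.Rank i j).
Proof.
rewrite sig_big_dep/= (reindex _ tagnat.rank_bij_on)/=.
by apply: eq_bigr => -[i j] _.
Qed.

Lemma hnorm_mxcol (m : nat) (p_ : 'I_m -> nat)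
    (C_ : forall i, 'cV[R[i]]_(p_ i)) :
  hnorm (\mxcol_i C_ i) ^+ 2 = \sum_i hnorm (C_ i) ^+ 2.
Proof.
rewrite hnorm_sqr sum_Rank; apply: eq_bigr => i _.
rewrite hnorm_sqr; apply: eq_bigr => j _; congr (cabs _ ^+ 2).
by rewrite -[in RHS](mxcolK C_ i) [in RHS]mxE.
Qed.

Lemma hnorm_col_mx m n (u : 'cV[R[i]]_m) (v : 'cV[R[i]]_n) :
  hnorm (col_mx u v) ^+ 2 = hnorm u ^+ 2 + hnorm v ^+ 2.
Proof.
rewrite !hnorm_sqr big_split_ord/=; congr (_ + _).
  by apply: eq_bigr => i _; rewrite col_mxEu.
by apply: eq_bigr => i _; rewrite col_mxEd.
Qed.

Lemma hnorm_mxcol_mul m p n (A : 'M[R[i]]_(p, n)) (E : 'I_m -> 'cV[R[i]]_n) :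
  hnorm (\mxcol_k (A *m E k)) <= opnorm A * hnorm (\mxcol_k E k).
Proof.
apply: hnorm_le; first by rewrite mulr_ge0 ?opnorm_ge0 ?hnorm_ge0.
rewrite -hnorm_sqr hnorm_mxcol exprMn hnorm_mxcol big_distrr/=.
apply: ler_sum => k _; rewrite -exprMn ler_pXn2r ?opnorm_ub//.
  by rewrite nnegrE hnorm_ge0.
by rewrite nnegrE mulr_ge0 ?opnorm_ge0 ?hnorm_ge0.
Qed.

Lemma opnorm_mxblock_mul m p n (a : 'M[R[i]]_(p, n)) (b : 'M[R[i]]_(n, p))
    (F : 'I_m -> 'I_m -> 'M[R[i]]_n) :
  opnorm (\mxblock_(k, l) (a *m F k l *m b)) <=
  opnorm a * opnorm (\mxblock_(k, l) F k l) * opnorm b.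
Proof.
apply: opnorm_le => [|v]; first by rewrite !mulr_ge0 ?opnorm_ge0.
rewrite -(submxcolK v); set C := submxcol v.
rewrite mul_mxblock_mxrow; set D := fun k => \sum_l (F k l *m (b *m C l)).
have -> : \mxcol_k (\sum_l (a *m F k l *m b *m C l)) = \mxcol_k (a *m D k).
  apply: eq_mxcol => k; rewrite mulmx_sumr.
  by apply: eq_bigr => l _; rewrite !mulmxA.
apply: le_trans (hnorm_mxcol_mul _ _) _.
rewrite -!mulrA ler_wpM2l ?opnorm_ge0// /D -mul_mxblock_mxrow.
apply: le_trans (opnorm_ub _ _) _; rewrite ler_wpM2l ?opnorm_ge0//.
exact: hnorm_mxcol_mul.
Qed.

Lemma col_mx_sum m n p (I : finType) (u : I -> 'M[R[i]]_(m, p))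
    (w : I -> 'M[R[i]]_(n, p)) :
  \sum_i col_mx (u i) (w i) = col_mx (\sum_i u i) (\sum_i w i).
Proof.
elim/big_rec3: _ => [|i x y z _ ->]; first by rewrite col_mx0.
by rewrite add_col_mx.
Qed.

Lemma opnorm_mxblock_dsum m p n (F : 'I_m -> 'I_m -> 'M[R[i]]_p)
    (G : 'I_m -> 'I_m -> 'M[R[i]]_n) (M : R) :
  opnorm (\mxblock_(k, l) F k l) <= M -> opnorm (\mxblock_(k, l) G k l) <= M ->
  opnorm (\mxblock_(k, l) block_mx (F k l) 0 0 (G k l)) <= M.
Proof.
move=> FM GM; have M0 : 0 <= M := le_trans (opnorm_ge0 _) FM.
have sq r (E : 'I_m -> 'I_m -> 'M[R[i]]_r) (u : 'I_m -> 'cV[R[i]]_r) :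
    opnorm (\mxblock_(k, l) E k l) <= M ->
    hnorm (\mxcol_k \sum_l (E k l *m u l)) ^+ 2 <=
    M ^+ 2 * hnorm (\mxcol_k u k) ^+ 2.
  move=> EM; rewrite -mul_mxblock_mxrow -exprMn.
  rewrite ler_pXn2r ?nnegrE ?mulr_ge0 ?hnorm_ge0//.
  by apply: le_trans (opnorm_ub _ _) _; rewrite ler_wpM2r ?hnorm_ge0.
apply: opnorm_le => // v; rewrite -(submxcolK v); set C := submxcol v.
rewrite mul_mxblock_mxrow; apply: hnorm_le; first by rewrite mulr_ge0 ?hnorm_ge0.
have CE : \mxcol_k C k = \mxcol_k col_mx (usubmx (C k)) (dsubmx (C k)).
  by apply: eq_mxcol => k; rewrite vsubmxK.
have cols r (u : 'I_m -> 'cV[R[i]]_p) (w : 'I_m -> 'cV[R[i]]_r) :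
    hnorm (\mxcol_k col_mx (u k) (w k)) ^+ 2 =
    hnorm (\mxcol_k u k) ^+ 2 + hnorm (\mxcol_k w k) ^+ 2.
  by rewrite !hnorm_mxcol -big_split/=; apply: eq_bigr => k _; rewrite hnorm_col_mx.
rewrite -hnorm_sqr exprMn CE cols.
rewrite (_ : \mxcol_k _ = \mxcol_k col_mx (\sum_l (F k l *m usubmx (C l)))
    (\sum_l (G k l *m dsubmx (C l)))); last first.
  apply: eq_mxcol => k; rewrite -col_mx_sum; apply: eq_bigr => l _.
  by rewrite -{1}[C l]vsubmxK mul_block_col !mul0mx addr0 add0r.
by rewrite cols mulrDr lerD ?sq.
Qed.

Lemma opnorm_mxblock1 m (A : 'M[R[i]]_m) :
  opnorm (\mxblock_(k < m, l < m) ((A k l)%:M : 'M_1)) <= opnorm A.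
Proof.
apply: opnorm_le => [|v]; first exact: opnorm_ge0.
have h (u : 'I_m -> 'cV[R[i]]_1) :
    hnorm (\mxcol_k u k) = hnorm (\col_k u k 0 0).
  apply/eqP; rewrite -(@eqrXn2 _ 2) ?hnorm_ge0// hnorm_mxcol hnorm_sqr.
  by apply/eqP/eq_bigr => k _; rewrite hnorm_sqr big_ord1 mxE.
rewrite -(submxcolK v) mul_mxblock_mxrow !h; set C := submxcol v.
rewrite (_ : \col_k _ = A *m \col_k C k 0 0) ?opnorm_ub//.
apply/matrixP => k j; rewrite !mxE summxE; apply: eq_bigr => l _.
by rewrite mul_scalar_mx !mxE.
Qed.

Lemma mxblock_Rank (T : Type) m n (B : 'I_m -> 'I_m -> 'M[T]_n) k l i j :
  (\mxblock_(k, l) B k l) (tagnat.Rank k i) (tagnat.Rank l j) = B k l i j.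
Proof. by rewrite -[in RHS](mxblockK B k l) [in RHS]mxE. Qed.

End opnorm_theory.

(* Abstract operator spaces, by Ruan's axioms: norms on all the M_n(X), that of
   M_1(X) being the norm of X, such that
     ||x (+) y|| = max(||x||, ||y||)  and  ||a x b|| <= ||a|| ||x|| ||b||
   for scalar matrices a and b. For n = 0 the axioms only say that the norm
   is 0. Completeness is not part of the structure: below it is a consequence of
   i_X(X) being closed in X^** . *)
HB.mixin Record NormedModule_isOperatorSpace (R : realType) X
    & NormedModule R[i] X := {
  osnorm : forall n : nat, 'M[X]_n -> R;
  osnorm1 : forall x : X, `|x| = (osnorm 1 (const_mx x))%:C;
  ler_osnormD : forall (n : nat) (x y : 'M[X]_n),
    osnorm n (x + y) <= osnorm n x + osnorm n y;
  osnormZ : forall (n : nat) (c : R[i]) (x : 'M[X]_n),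
    osnorm n (map_mx ( *:%R c) x) = cabs c * osnorm n x;
  osnorm0_eq0 : forall (n : nat) (x : 'M[X]_n), osnorm n x = 0 -> x = 0;
  osnorm_dsum : forall (m n : nat) (x : 'M[X]_m) (y : 'M[X]_n),
    osnorm (m + n) (block_mx x 0 0 y) = Num.max (osnorm m x) (osnorm n y);
  osnorm_act : forall (p n : nat) (a : 'M[R[i]]_(p, n)) (x : 'M[X]_n)
    (b : 'M[R[i]]_(n, p)),
    osnorm p (mxact a x b) <= opnorm a * osnorm n x * opnorm b
}.

#[short(type="operatorSpaceType")]
HB.structure Definition OperatorSpace (R : realType) :=
  {X of NormedModule R[i] X & NormedModule_isOperatorSpace R X}.

Arguments osnorm {R s n} x : rename.
Arguments ler_osnormD {R s n} x y : rename.
Arguments osnormZ {R s n} c x : rename.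
Arguments osnorm0_eq0 {R s n} x : rename.
Arguments osnorm_dsum {R s m n} x y : rename.
Arguments osnorm_act {R s p n} a x b : rename.

(* The cb-norm sup_n ||T_n||, with respect to given families of matrix norms;
   it is only used for maps X -> M_n(C), where the supremum is finite by
   dual_osnorm_has_sup. *)
Definition cbnorm (R : realType) (X Y : Type)
    (NX : forall n, 'M[X]_n -> R) (NY : forall n, 'M[Y]_n -> R)
    (T : X -> Y) : R :=
  sup (\bigcup_n [set NY n (map_mx T x) | x in [set x : 'M[X]_n | NX n x <= 1]]).

(* Matrix norms of M_n(C), from the identification M_m(M_n(C)) = M_{mn}(C). *)
Definition Mn_norm (R : realType) (n m : nat) (A : 'M['M[R[i]]_n]_m) : R :=
  opnorm (\mxblock_(k < m, l < m) A k l).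

Definition dual_pred (R : realType) (X : operatorSpaceType R) :
  {pred X -> R[i]^o} := fun f => `[< linear f /\ continuous f >].

Record dual (R : realType) (X : operatorSpaceType R) := Dual {
  dual_fun :> X -> R[i]^o;
  _ : dual_fun \in @dual_pred R X
}.

Section dual_lmodule.
Context (R : realType) (X : operatorSpaceType R).

HB.instance Definition _ := [isSub of dual X for @dual_fun R X].
HB.instance Definition _ := [Choice of dual X by <:].

Lemma dual_submod_closed : submod_closed (@dual_pred R X).
Proof.
split.
  apply/asboolP; split; last exact: cst_continuous.
  by move=> a x y; rewrite -[RHS]/(a *: (0 : R[i]^o) + 0) scaler0 addr0.
move=> a f g /asboolP[lf cf] /asboolP[lg cg]; apply/asboolP; split.
  move=> b x y; rewrite -[LHS]/(a *: f (b *: x + y) + g (b *: x + y)).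
  rewrite -[RHS]/(b *: (a *: f x + g x) + (a *: f y + g y)) lf lg.
  by rewrite !scalerDr !scalerA [a * b]mulrC -!addrA; congr (_ + _); rewrite addrCA.
move=> x; apply: cvgD; last exact: cg.
by apply: cvgZr; exact: cf.
Qed.

HB.instance Definition _ :=
  GRing.isSubmodClosed.Build _ _ (@dual_pred R X) dual_submod_closed.
HB.instance Definition _ := [SubChoice_isSubLmodule of dual X by <:].

Lemma dualP (f : dual X) : linear f /\ continuous f.
Proof. by case: f => f /= /asboolP. Qed.

HB.instance Definition _ (f : dual X) :=
  GRing.isLinear.Build _ _ _ _ (dual_fun f) (dualP f).1.

Lemma dual0E (x : X) : (0 : dual X) x = 0. Proof. by []. Qed.

Lemma dualDE (f g : dual X) (x : X) : (f + g) x = f x + g x. Proof. by []. Qed.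

Lemma dualZE (c : R[i]) (f : dual X) (x : X) : (c *: f) x = c * f x.
Proof. by []. Qed.

Lemma dual_sumE (I : finType) (F : I -> dual X) (x : X) :
  (\sum_i F i) x = \sum_i F i x.
Proof. by elim/big_rec2: _ => // i y z _ <-. Qed.

End dual_lmodule.

Section osnorm_theory.
Context (R : realType) (X : operatorSpaceType R).

Lemma osnorm0 n : osnorm (0 : 'M[X]_n) = 0.
Proof.
have := osnormZ 0 (0 : 'M[X]_n); rewrite cabs0 mul0r => <-; congr osnorm.
by apply/matrixP => i j; rewrite !mxE scaler0.
Qed.

Lemma osnorm_ge0 n (x : 'M[X]_n) : 0 <= osnorm x.
Proof.
have := ler_osnormD x (map_mx ( *:%R (-1)) x); rewrite osnormZ.
rewrite (_ : x + _ = 0) ?osnorm0; last first.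
  by apply/matrixP => i j; rewrite !mxE scaleN1r subrr.
have -> : cabs (-1 : R[i]) = 1 by rewrite -[1]/(1%:C) -rmorphN cabsC normrN1.
by rewrite mul1r -mulr2n pmulrn_lge0.
Qed.

(* A bounded functional is completely bounded, with the same bound. *)
Lemma opnorm_map_dual m (f : dual X) (K : R) (x : 'M[X]_m) : 0 <= K ->
  (forall y : X, cabs (f y) <= K * osnorm (const_mx y : 'M_1)) ->
  opnorm (map_mx f x : 'M[R[i]]_m) <= K * osnorm x.
Proof.
move=> K0 fK; apply: opnorm_le => [|v]; first by rewrite mulr_ge0 ?osnorm_ge0.
set w := _ *m v; pose a : 'rV[R[i]]_m := \row_j (w j 0)^*%C.
have [->|w0] := eqVneq (hnorm w) 0; first by rewrite !mulr_ge0 ?osnorm_ge0 ?hnorm_ge0.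
have wp : 0 < hnorm w by rewrite lt_neqAle eq_sym w0 hnorm_ge0.
rewrite -(ler_pM2r wp) -expr2.
pose y := \sum_k \sum_l (a 0 k * v l 0) *: x k l.
have -> : hnorm w ^+ 2 = cabs (f y).
  rewrite -[LHS]ger0_norm ?sqr_ge0// -cabsC hnorm_sqr_adj; congr cabs.
  rewrite linear_sum; apply: eq_bigr => k _; rewrite linear_sum {2}/w mxE.
  rewrite mulr_sumr; apply: eq_bigr => l _; rewrite linearZ/= !mxE.
  by rewrite -[RHS]/(_ * _) -mulrA; congr (_ * _); rewrite mulrC.
apply: le_trans (fK y) _; rewrite -!mulrA ler_wpM2l//.
have -> : (const_mx y : 'M_1) = mxact a x v.
  by apply/matrixP => i j; rewrite !mxE !ord1.
apply: le_trans (osnorm_act _ _ _) _.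
have -> : osnorm x * (hnorm v * hnorm w) = hnorm w * osnorm x * hnorm v.
  by ring.
apply: ler_pM; rewrite ?mulr_ge0 ?opnorm_ge0 ?osnorm_ge0//.
  by rewrite ler_wpM2r ?osnorm_ge0 ?opnorm_adj.
exact: opnorm_col.
Qed.

End osnorm_theory.


Section dual_norm.
Context (R : realType) (X : operatorSpaceType R).
Implicit Types (f g : dual X) (x : X).

Let nrm x : R := osnorm (const_mx x : 'M[X]_1).

Lemma dual_bounded f : exists2 K : R, 0 <= K & forall x, cabs (f x) <= K * nrm x.
Proof.
have /continuous_linear_bounded : {for 0, continuous f} by exact: (dualP f).2.
move=> /(_ 0)/linear_boundedP/pinfty_ex_gt0[r r0 fr].
case: r r0 fr => [a b]; rewrite ltcE/= => /andP[/eqP -> a0] fr.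
exists a; first exact: ltW.
by move=> x; rewrite -lecR rmorphM/= -osnorm1; exact: fr.
Qed.

Lemma dual_has_sup f :
  has_sup [set cabs (f x) | x in [set x : X | `|x| <= 1]].
Proof.
split; first by exists (cabs (f 0)), 0; rewrite //= normr0 ler01.
have [K K0 fK] := dual_bounded f; exists K => _ [x /= x1 <-].
rewrite (le_trans (fK x))// ler_piMr// -lecR -osnorm1 (le_trans x1)//.
Qed.

Definition dual_norm f : R :=
  sup [set cabs (f x) | x in [set x : X | `|x| <= 1]].

Lemma dual_norm_ge0 f : 0 <= dual_norm f.
Proof.
apply: le_trans (cabs_ge0 (f 0)) _; apply: (ub_le_sup (dual_has_sup f).2).
by exists 0; rewrite //= normr0 ler01.
Qed.

Lemma dual_norm_ub f x : cabs (f x) <= dual_norm f * nrm x.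
Proof.
have [x0|x0] := eqVneq x 0.
  by rewrite x0 linear0 cabs0 mulr_ge0 ?dual_norm_ge0 ?osnorm_ge0.
have xp : 0 < nrm x by rewrite -ltcR -osnorm1 normr_gt0.
rewrite -ler_pdivrMr//; apply: (ub_le_sup (dual_has_sup f).2).
have E : cabs (nrm x)^-1%:C = (nrm x)^-1.
  by rewrite cabsC ger0_norm// invr_ge0 ltW.
exists ((nrm x)^-1%:C *: x) => /=.
  by rewrite normrZ osnorm1 normcE E -rmorphM mulVf ?gt_eqF.
by rewrite linearZ/= cabsM E mulrC.
Qed.

Lemma dual_norm_le f (M : R) :
  (forall x, `|x| <= 1 -> cabs (f x) <= M) -> dual_norm f <= M.
Proof.
move=> fM; apply: ge_sup; first exact: (dual_has_sup f).1.
by move=> _ [x /= x1 <-]; exact: fM.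
Qed.

Lemma cabs_dual_norm f x : `|x| <= 1 -> cabs (f x) <= dual_norm f.
Proof. by move=> x1; apply: (ub_le_sup (dual_has_sup f).2); exists x. Qed.

Let dual_ler_normD f g :
  (dual_norm (f + g))%:C <= (dual_norm f)%:C + (dual_norm g)%:C.
Proof.
rewrite -rmorphD lecR; apply: dual_norm_le => x x1; rewrite dualDE.
by rewrite (le_trans (cabsD _ _))// lerD ?cabs_dual_norm.
Qed.

Let dual_normrZ (c : R[i]) f :
  (dual_norm (c *: f))%:C = `|c| * (dual_norm f)%:C.
Proof.
have h d g : dual_norm (d *: g) <= cabs d * dual_norm g.
  apply: dual_norm_le => x x1.
  by rewrite dualZE cabsM ler_wpM2l ?cabs_ge0 ?cabs_dual_norm.
rewrite normcE -rmorphM; congr (_%:C); apply/eqP; rewrite eq_le h/=.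
have [->|c0] := eqVneq c 0; first by rewrite cabs0 mul0r dual_norm_ge0.
have cp : 0 < cabs c.
  rewrite lt_neqAle cabs_ge0 andbT eq_sym; apply: contra c0 => /eqP.
  by move/cabs0_eq0 ->.
have := h c^-1 (c *: f); rewrite scalerA mulVf// scale1r.
rewrite -(ler_pM2l cp) mulrA -cabsM mulfV// => /le_trans; apply.
by rewrite cabsC normr1 mul1r.
Qed.

Let dual_normr0_eq0 f : (dual_norm f)%:C = 0 -> f = 0.
Proof.
move=> [f0]; apply/val_inj/funext => x /=.
apply: cabs0_eq0; apply/eqP; rewrite eq_le cabs_ge0 andbT.
by rewrite (le_trans (dual_norm_ub f x))// f0 mul0r.
Qed.

HB.instance Definition _ := Lmodule_isNormed.Build R[i] (dual X)
  dual_ler_normD dual_normrZ dual_normr0_eq0.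

Lemma dual_normE f : `|f| = (dual_norm f)%:C. Proof. by []. Qed.

(* The standard dual structure: M_n of the dual of X is CB(X, M_n(C)). *)
Definition dual_osnorm n (f : 'M[dual X]_n) : R :=
  cbnorm (fun m (x : 'M[X]_m) => osnorm x) (@Mn_norm R n)
    (fun x => map_mx (fun g : dual X => g x : R[i]) f).

Let blk n m (f : 'M[dual X]_n) (x : 'M[X]_m) :=
  \mxblock_(k < m, l < m) \matrix_(i < n, j < n) (f i j (x k l) : R[i]).

Let blkE n m (f : 'M[dual X]_n) (x : 'M[X]_m) :
  Mn_norm (map_mx (fun x => map_mx (fun g : dual X => g x : R[i]) f) x) =
  opnorm (blk f x).
Proof.
congr opnorm; apply: eq_mxblock => k l.
by apply/matrixP => i j; rewrite !mxE.
Qed.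

Let blkZ n m (f : 'M[dual X]_n) (c : R[i]) (x : 'M[X]_m) :
  blk f (map_mx ( *:%R c) x) = c *: blk f x.
Proof. by apply/matrixP => s t; rewrite !mxE linearZ. Qed.

Let blk_bounded n (f : 'M[dual X]_n) :
  exists2 K : R, 0 <= K &
    forall m (x : 'M[X]_m), opnorm (blk f x) <= K * osnorm x.
Proof.
exists (\sum_i \sum_j dual_norm (f i j)).
  by do 2!apply: sumr_ge0 => ? _; exact: dual_norm_ge0.
move=> m x.
have -> : blk f x = \sum_i \sum_j \mxblock_(k, l)
    ((delta_mx i 0 : 'cV[R[i]]_n) *m
     ((map_mx (f i j) x : 'M[R[i]]_m) k l)%:M *m (delta_mx 0 j : 'rV[R[i]]_n)).
  pose B i j k l := (delta_mx i 0 : 'cV[R[i]]_n) *m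
    ((map_mx (f i j) x : 'M[R[i]]_m) k l)%:M *m (delta_mx 0 j : 'rV[R[i]]_n).
  transitivity (\mxblock_(k, l) \sum_i \sum_j B i j k l); last first.
    rewrite mxblock_sum; apply: eq_bigr => i _.
    by rewrite mxblock_sum; apply: eq_bigr.
  apply: eq_mxblock => k l; rewrite /B.
  apply/matrixP => i j; rewrite mxE summxE (bigD1 i)//= summxE (bigD1 j)//=.
  rewrite mul_mx_scalar -scalemxAl mul_delta_mx !mxE !eqxx mulr1.
  rewrite big1 ?addr0 => [|j' /negPf jj']; last first.
    by rewrite mul_mx_scalar -scalemxAl mul_delta_mx !mxE eq_sym jj' andbF mulr0.
  rewrite big1 ?addr0 => [//|i' /negPf ii'].
  rewrite summxE big1// => j' _.
  by rewrite mul_mx_scalar -scalemxAl mul_delta_mx !mxE eq_sym ii' mulr0.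
apply: le_trans (opnorm_sum _) _; rewrite mulr_suml; apply: ler_sum => i _.
apply: le_trans (opnorm_sum _) _; rewrite mulr_suml; apply: ler_sum => j _.
apply: le_trans (opnorm_mxblock_mul _ _ _) _.
have d1 : opnorm (delta_mx i 0 : 'cV[R[i]]_n) <= 1.
  apply: le_trans (opnorm_col _) _.
  apply: hnorm_le => //; rewrite (bigD1 i)//= big1 ?addr0.
    by rewrite mxE !eqxx cabsC normr1.
  by move=> k /negPf ki; rewrite mxE ki cabs0 expr0n.
have d2 : opnorm (delta_mx 0 j : 'rV[R[i]]_n) <= 1.
  apply: opnorm_le => // v; apply: hnorm_le.
    by rewrite mul1r hnorm_ge0.
  rewrite big_ord1 mul1r ler_pXn2r ?nnegrE ?cabs_ge0 ?hnorm_ge0//.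
  rewrite mxE (bigD1 j)//= mxE !eqxx mul1r big1 ?addr0 ?cabs_le_hnorm//.
  by move=> k /negPf kj; rewrite mxE kj andbF mul0r.
rewrite -[leRHS]mulr1; apply: ler_pM; rewrite ?mulr_ge0 ?opnorm_ge0//.
rewrite -[leRHS]mul1r; apply: ler_pM; rewrite ?opnorm_ge0//.
apply: le_trans (opnorm_mxblock1 _) _.
by apply: opnorm_map_dual; [exact: dual_norm_ge0|exact: dual_norm_ub].
Qed.

Lemma dual_osnorm_has_sup n (f : 'M[dual X]_n) :
  has_sup (\bigcup_m [set Mn_norm
    (map_mx (fun x => map_mx (fun g : dual X => g x : R[i]) f) x) |
    x in [set x : 'M[X]_m | osnorm x <= 1]]).
Proof.
split.
  by eexists; exists 0%N => //; exists 0 => //=; rewrite osnorm0 ler01.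
have [K K0 fK] := blk_bounded f; exists K => _ [m _ [x /= x1 <-]].
by rewrite blkE (le_trans (fK _ _))// ler_piMr.
Qed.

Let dual_osnorm_ub n (f : 'M[dual X]_n) m (x : 'M[X]_m) :
  opnorm (blk f x) <= dual_osnorm f * osnorm x.
Proof.
have ub (y : 'M[X]_m) : osnorm y <= 1 -> opnorm (blk f y) <= dual_osnorm f.
  move=> y1; apply: (ub_le_sup (dual_osnorm_has_sup f).2).
  by exists m => //; exists y => //; rewrite blkE.
have [x0|x0] := eqVneq (osnorm x) 0.
  have [K K0 fK] := blk_bounded f.
  by rewrite x0 mulr0 (le_trans (fK _ x))// x0 mulr0.
have xp : 0 < osnorm x by rewrite lt_neqAle eq_sym x0 osnorm_ge0.
have E : cabs (osnorm x)^-1%:C = (osnorm x)^-1.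
  by rewrite cabsC ger0_norm// invr_ge0 ltW.
rewrite -ler_pdivrMr// mulrC -E -opnormZ -blkZ; apply: ub.
by rewrite osnormZ E mulVf.
Qed.

Let dual_osnorm_le n (f : 'M[dual X]_n) (M : R) : 0 <= M ->
  (forall m (x : 'M[X]_m), opnorm (blk f x) <= M * osnorm x) ->
  dual_osnorm f <= M.
Proof.
move=> M0 fM; apply: ge_sup; first exact: (dual_osnorm_has_sup f).1.
by move=> _ [m _ [x /= x1 <-]]; rewrite blkE (le_trans (fM _ _))// ler_piMr.
Qed.

Let dual_osnorm_ge0 n (f : 'M[dual X]_n) : 0 <= dual_osnorm f.
Proof.
apply: le_trans (ub_le_sup (dual_osnorm_has_sup f).2 _); last first.
  by exists 0%N => //; exists 0 => //=; rewrite osnorm0 ler01.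
exact: opnorm_ge0.
Qed.

Let dual_osnorm1 f : `|f| = (dual_osnorm (const_mx f : 'M_1))%:C.
Proof.
congr (_%:C); apply/eqP; rewrite eq_le; apply/andP; split.
  apply: dual_norm_le => x x1.
  have : cabs (f x) <= opnorm (blk (const_mx f : 'M_1) (const_mx x : 'M_1)).
    apply: le_trans (cabs_le_opnorm _ (tagnat.Rank 0 0) (tagnat.Rank 0 0)).
    by rewrite mxblock_Rank !mxE.
  move/le_trans; apply; apply: le_trans (dual_osnorm_ub _ _) _.
  by rewrite ler_piMr ?dual_osnorm_ge0// -lecR -osnorm1.
apply: dual_osnorm_le => [|m x]; first exact: dual_norm_ge0.
have -> : blk (const_mx f : 'M_1) x =
    \mxblock_(k, l) (((map_mx f x : 'M[R[i]]_m) k l)%:M : 'M_1).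
  apply: eq_mxblock => k l; apply/matrixP => i j.
  by rewrite !mxE !ord1.
apply: le_trans (opnorm_mxblock1 _) _.
by apply: opnorm_map_dual; [exact: dual_norm_ge0|exact: dual_norm_ub].
Qed.

Let dual_ler_osnormD n (f g : 'M[dual X]_n) :
  dual_osnorm (f + g) <= dual_osnorm f + dual_osnorm g.
Proof.
apply: dual_osnorm_le => [|m x]; first by rewrite addr_ge0 ?dual_osnorm_ge0.
have -> : blk (f + g) x = blk f x + blk g x.
  by rewrite -mxblockD; apply: eq_mxblock => k l; apply/matrixP => i j; rewrite !mxE.
by rewrite mulrDl (le_trans (opnormD _ _))// lerD ?dual_osnorm_ub.
Qed.

Let dual_osnormZ n (c : R[i]) (f : 'M[dual X]_n) :
  dual_osnorm (map_mx ( *:%R c) f) = cabs c * dual_osnorm f.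
Proof.
have h d (g : 'M[dual X]_n) :
    dual_osnorm (map_mx ( *:%R d) g) <= cabs d * dual_osnorm g.
  apply: dual_osnorm_le => [|m x]; first by rewrite mulr_ge0 ?cabs_ge0 ?dual_osnorm_ge0.
  have -> : blk (map_mx ( *:%R d) g) x = d *: blk g x.
    by apply/matrixP => s t; rewrite !mxE dualZE.
  by rewrite opnormZ -mulrA ler_wpM2l ?cabs_ge0 ?dual_osnorm_ub.
apply/eqP; rewrite eq_le h/=.
have [->|c0] := eqVneq c 0; first by rewrite cabs0 mul0r dual_osnorm_ge0.
have cp : 0 < cabs c.
  rewrite lt_neqAle cabs_ge0 andbT eq_sym; apply: contra c0 => /eqP.
  by move/cabs0_eq0 ->.
have := h c^-1 (map_mx ( *:%R c) f).
rewrite (_ : map_mx _ (map_mx _ _) = f); last first.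
  by apply/matrixP => i j; rewrite !mxE scalerA mulVf// scale1r.
rewrite -(ler_pM2l cp) mulrA -cabsM mulfV// => /le_trans; apply.
by rewrite cabsC normr1 mul1r.
Qed.

Let dual_osnorm0_eq0 n (f : 'M[dual X]_n) : dual_osnorm f = 0 -> f = 0.
Proof.
move=> f0; apply/matrixP => i j; rewrite mxE; apply/val_inj/funext => x /=.
apply: cabs0_eq0; apply/eqP; rewrite eq_le cabs_ge0 andbT.
have := dual_osnorm_ub f (const_mx x : 'M_1); rewrite f0 mul0r.
apply: le_trans.
apply: le_trans (cabs_le_opnorm _ (tagnat.Rank 0 i) (tagnat.Rank 0 j)).
by rewrite mxblock_Rank !mxE.
Qed.

Let dual_osnorm_act p n (a : 'M[R[i]]_(p, n)) (f : 'M[dual X]_n)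
    (b : 'M[R[i]]_(n, p)) :
  dual_osnorm (mxact a f b) <= opnorm a * dual_osnorm f * opnorm b.
Proof.
apply: dual_osnorm_le => [|m x]; first by rewrite !mulr_ge0 ?dual_osnorm_ge0 ?opnorm_ge0.
have -> : blk (mxact a f b) x = \mxblock_(k < m, l < m)
    (a *m (\matrix_(i < n, j < n) (f i j (x k l) : R[i])) *m b).
  apply: eq_mxblock => k l; apply/matrixP => i j; rewrite !mxE dual_sumE.
  under eq_bigr do rewrite dual_sumE.
  rewrite exchange_big/=; apply: eq_bigr => s _; rewrite mxE mulr_suml.
  apply: eq_bigr => t _.
  by rewrite mxE -[LHS]/(a i t * b s j * f t s (x k l)) mulrAC.
apply: le_trans (opnorm_mxblock_mul _ _ _) _.
rewrite [leRHS]mulrAC ler_wpM2r ?opnorm_ge0// -mulrA ler_wpM2l ?opnorm_ge0//.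
exact: dual_osnorm_ub.
Qed.

Let dual_osnorm_dsum m n (f : 'M[dual X]_m) (g : 'M[dual X]_n) :
  dual_osnorm (block_mx f 0 0 g) = Num.max (dual_osnorm f) (dual_osnorm g).
Proof.
apply/eqP; rewrite eq_le; apply/andP; split.
  apply: dual_osnorm_le => [|p x]; first by rewrite le_max dual_osnorm_ge0.
  have -> : blk (block_mx f 0 0 g) x = \mxblock_(k < p, l < p)
      block_mx (\matrix_(i < m, j < m) (f i j (x k l) : R[i])) 0 0
               (\matrix_(i < n, j < n) (g i j (x k l) : R[i])).
    apply: eq_mxblock => k l; apply/matrixP => i j; rewrite !mxE.
    by case: fintype.split => i'; rewrite !mxE; case: fintype.split => j'; rewrite !mxE.
  apply: opnorm_mxblock_dsum; apply: le_trans (dual_osnorm_ub _ _) _.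
    by rewrite ler_wpM2r ?osnorm_ge0// le_max lexx.
  by rewrite ler_wpM2r ?osnorm_ge0// le_max lexx orbT.
have cu : opnorm (col_mx 1%:M 0 : 'M[R[i]]_(m + n, m)) <= 1.
  apply: opnorm_le => // v; rewrite mul_col_mx mul1mx mul0mx mul1r.
  apply: hnorm_le; first exact: hnorm_ge0.
  by rewrite -hnorm_sqr hnorm_col_mx hnorm0 expr0n addr0.
have cd : opnorm (col_mx 0 1%:M : 'M[R[i]]_(m + n, n)) <= 1.
  apply: opnorm_le => // v; rewrite mul_col_mx mul1mx mul0mx mul1r.
  apply: hnorm_le; first exact: hnorm_ge0.
  by rewrite -hnorm_sqr hnorm_col_mx hnorm0 expr0n add0r.
have hle (v : 'cV[R[i]]_(m + n)) : hnorm (usubmx v) <= hnorm v /\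
    hnorm (dsubmx v) <= hnorm v.
  split; apply: hnorm_le; rewrite ?hnorm_ge0// -{2}[v]vsubmxK hnorm_col_mx
    -hnorm_sqr ?lerDl ?lerDr ?sqr_ge0//.
have ru : opnorm (row_mx 1%:M 0 : 'M[R[i]]_(m, m + n)) <= 1.
  apply: opnorm_le => // v; rewrite -{1}[v]vsubmxK mul_row_col mul1mx mul0mx addr0 mul1r.
  exact: (hle v).1.
have rd : opnorm (row_mx 0 1%:M : 'M[R[i]]_(n, m + n)) <= 1.
  apply: opnorm_le => // v; rewrite -{1}[v]vsubmxK mul_row_col mul1mx mul0mx add0r mul1r.
  exact: (hle v).2.
have compr p (a : 'M[R[i]]_(p, m + n)) (b : 'M[R[i]]_(m + n, p))
    (h : 'M[dual X]_(m + n)) : opnorm a <= 1 -> opnorm b <= 1 ->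
    dual_osnorm (mxact a h b) <= dual_osnorm h.
  move=> a1 b1; apply: le_trans (dual_osnorm_act _ _ _) _.
  rewrite -[leRHS]mulr1 ler_pM ?mulr_ge0 ?opnorm_ge0 ?dual_osnorm_ge0//.
  by rewrite ler_piMl ?dual_osnorm_ge0.
have fE : mxact (row_mx 1%:M 0) (block_mx f 0 0 g) (col_mx 1%:M 0) = f.
  apply/matrixP => i j; rewrite mxE big_split_ord/=.
  rewrite [X in _ + X = _]big1 ?addr0 => [|k _]; last first.
    by rewrite big1// => l _; rewrite row_mxEr mxE mul0r scale0r.
  rewrite (bigD1 i)//= [X in _ + X = _]big1 ?addr0 => [|k /negPf ki]; last first.
    by rewrite big1// => l _; rewrite row_mxEl mxE eq_sym ki mul0r scale0r.
  rewrite big_split_ord/= [X in _ + X = _]big1 ?addr0 => [|l _]; last first.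
    by rewrite col_mxEd [X in _ * X]mxE mulr0 scale0r.
  rewrite (bigD1 j)//= big1 ?addr0 => [|l /negPf lj]; last first.
    by rewrite col_mxEu [X in _ * X]mxE lj mulr0 scale0r.
  by rewrite row_mxEl col_mxEu block_mxEul !mxE !eqxx mulr1 scale1r.
have gE : mxact (row_mx 0 1%:M) (block_mx f 0 0 g) (col_mx 0 1%:M) = g.
  apply/matrixP => i j; rewrite mxE big_split_ord/=.
  rewrite [X in X + _ = _]big1 ?add0r => [|k _]; last first.
    by rewrite big1// => l _; rewrite row_mxEl mxE mul0r scale0r.
  rewrite (bigD1 i)//= [X in _ + X = _]big1 ?addr0 => [|k /negPf ki]; last first.
    by rewrite big1// => l _; rewrite row_mxEr mxE eq_sym ki mul0r scale0r.
  rewrite big_split_ord/= [X in X + _ = _]big1 ?add0r => [|l _]; last first.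
    by rewrite col_mxEu [X in _ * X]mxE mulr0 scale0r.
  rewrite (bigD1 j)//= big1 ?addr0 => [|l /negPf lj]; last first.
    by rewrite col_mxEd [X in _ * X]mxE lj mulr0 scale0r.
  by rewrite row_mxEr col_mxEd block_mxEdr !mxE !eqxx mulr1 scale1r.
have f_le := compr _ _ _ (block_mx f 0 0 g) ru cu.
have g_le := compr _ _ _ (block_mx f 0 0 g) rd cd.
by move: f_le g_le; rewrite fE gE ge_max => -> ->.
Qed.

HB.instance Definition _ := NormedModule_isOperatorSpace.Build R (dual X)
  dual_osnorm1 dual_ler_osnormD dual_osnormZ dual_osnorm0_eq0
  dual_osnorm_dsum dual_osnorm_act.

End dual_norm.

Section canonical_embedding.
Context (R : realType) (X : operatorSpaceType R).

Lemma bidual_eval_subproof (x : X) :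
  (fun f : dual X => f x : R[i]^o) \in @dual_pred R (dual X).
Proof.
have lin : linear (fun f : dual X => f x : R[i]^o) by [].
pose L : {linear dual X -> R[i]^o} :=
  HB.pack (fun f : dual X => f x : R[i]^o) (GRing.isLinear.Build _ _ _ _ _ lin).
apply/asboolP; split => //.
apply: (@bounded_linear_continuous _ _ _ L).
apply/linear_boundedP; exists `|x|; split; first exact: normr_real.
move=> r xr f /=; rewrite mulrC.
apply: le_trans (ler_wpM2l (normr_ge0 f) (ltW xr)).
by rewrite dual_normE osnorm1 normcE -rmorphM lecR dual_norm_ub.
Qed.

Definition bidual_embed (x : X) : dual (dual X) :=
  Dual (bidual_eval_subproof x).

End canonical_embedding.

Section one_sided_M_structure.
Context (R : realType).
Implicit Types X Y : operatorSpaceType R.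

Definition completely_contractive X Y (T : X -> Y) : Prop :=
  forall n (x : 'M[X]_n), osnorm (map_mx T x) <= osnorm x.

(* Complete isometry with respect to given families of matrix norms. *)
Definition complete_isometry (U V : Type) (NU : forall n, 'M[U]_n -> R)
    (NV : forall n, 'M[V]_n -> R) (T : U -> V) : Prop :=
  forall n (x : 'M[U]_n), NV n (map_mx T x) = NU n x.

(* Matrix norms of M_2(X), from the identification M_n(M_2(X)) = M_{2n}(X). *)
Definition M2_norm X n (z : 'M['M[X]_2]_n) : R :=
  osnorm (\mxblock_(k < n, l < n) z k l).

(* An element of C_2(X), seen in M_2(X) as its first column. *)
Definition C2_col X (a b : X) : 'M[X]_2 :=
  \matrix_(i, j) if j == 0 then (if i == 0 then a else b) else 0.

Definition complete_left_M_projection X (P : {linear X -> X}) : Prop :=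
  (forall x, P (P x) = P x) /\
  complete_isometry (fun n (x : 'M[X]_n) => osnorm x) (@M2_norm X)
    (fun x => C2_col (P x) (x - P x)).

Definition right_M_summand X (J : set X) : Prop :=
  exists2 P : {linear X -> X}, complete_left_M_projection P & J = range P.

Definition annihilator X (J : set X) : set (dual X) :=
  [set f : dual X | forall x, J x -> f x = 0].

Definition right_M_ideal X (J : set X) : Prop :=
  [/\ submod_closed (mem J), closed J &
      right_M_summand (annihilator (annihilator J))].

Definition right_M_embedded X : Prop :=
  right_M_ideal (range (@bidual_embed R X)).

Definition reflexive_space X : Prop := range (@bidual_embed R X) = setT.

Definition unique_extension_property X : Prop :=
  forall T : {linear dual (dual X) -> dual (dual X)},
    completely_contractive T ->
    (forall x : X, T (bidual_embed x) = bidual_embed x) ->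
    T =1 id.

End one_sided_M_structure.

(* Main.v *)
Require Import Defs.
From mathcomp Require Import all_boot all_order all_algebra complex.
From mathcomp Require Import boolp classical_sets reals topology normedtype.

Set Implicit Arguments.
Unset Strict Implicit.
Unset Printing Implicit Defensive.

Import Order.TTheory GRing.Theory Num.Theory.
Import numFieldNormedType.Exports.

Local Open Scope classical_set_scope.
Local Open Scope complex_scope.
Local Open Scope ring_scope.

(** The theorem is an instance of the uniqueness of norm-preserving extensions
from a right $M$-ideal, in the same way as for classical $M$-ideals.

If $P$ is a complete left $M$-projection, the column isometry
$z \mapsto (Pz, z - Pz)$ forces $\|su + tv\| \le (|s|^2 + |t|^2)^{1/2}$ for
$u$ in the range and $v$ in the kernel of $P$, both of norm at most one
([left_M_projection_norm]). A functional $f$ with $f(v) \ne 0$ therefore has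
$\|f\|^2 \ge |f(u)|^2 + |f(v)|^2$ for all such $u$, so its norm cannot be
approached on the unit ball of the range: a functional which is normed by the
range vanishes on the kernel ([norming_range_vanishes]).

Let now $J$ be a right $M$-ideal of $Y$, with $P$ projecting $Y^{**}$ onto
$J^{\perp\perp}$. If $f, g \in Y^*$ agree on $J$ and are both normed by $J$,
then, viewed as functionals on $Y^{**}$, they both vanish on the kernel of $P$,
while $f - g$ vanishes on $J^{\perp\perp}$; hence $f = g$
([right_M_ideal_unique_extension]).

Finally, if $T$ is completely contractive on $X^{**}$ and fixes $X$, then for
every $f \in X^*$ the functionals $y \mapsto (Ty)(f)$ and $y \mapsto y(f)$ on
$X^{**}$ both extend $f$ without increasing its norm, so they coincide; as $f$
is arbitrary, $Ty = y$. *)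

Lemma osnorm_const_le1 (R : realType) (X : operatorSpaceType R) (x : X) :
  (`|x| <= 1) = (osnorm (const_mx x : 'M_1) <= 1).
Proof. by rewrite osnorm1 -lecR. Qed.

Lemma osnorm_const_dual (R : realType) (X : operatorSpaceType R) (f : dual X) :
  osnorm (const_mx f : 'M_1) = dual_norm f.
Proof.
by have [] : (osnorm (const_mx f : 'M_1))%:C = (dual_norm f)%:C
  by rewrite -osnorm1.
Qed.

(** Over the unit ball, the column with entries $su$ and $tv$ is the diagonal
matrix $u \oplus v$, of norm at most one, times the scalar column $(s, t)$, whose
norm is the Euclidean one. *)
Lemma M2_norm_column (R : realType) (X : operatorSpaceType R) (s t : R[i])
    (u v : X) :
  `|u| <= 1 -> `|v| <= 1 ->
  M2_norm (const_mx (C2_col (s *: u) (t *: v)) : 'M_1) <=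
  Num.sqrt (cabs s ^+ 2 + cabs t ^+ 2).
Proof.
rewrite !osnorm_const_le1 => u1 v1; set r := Num.sqrt _.
have r0 : 0 <= r by exact: sqrtr_ge0.
pose B : 'M[R[i]]_2 :=
  \matrix_(i, j) if j == 0 then (if i == 0 then s else t) else 0.
have Br : opnorm B <= r.
  apply: opnorm_le => // w.
  pose c : 'cV[R[i]]_2 := \col_i if i == 0 then s else t.
  have -> : B *m w = w 0 0 *: c.
    apply/matrixP => i j; rewrite (ord1 j) !mxE big_ord_recl big_ord1 !mxE /=.
    by rewrite mul0r addr0 mulrC.
  have -> : r = hnorm c by rewrite /hnorm big_ord_recl big_ord1 !mxE.
  by rewrite hnormZ mulrC ler_wpM2l ?hnorm_ge0 ?cabs_le_hnorm.
pose x : 'M[X]_(1 + 1) := block_mx (const_mx u) 0 0 (const_mx v).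
have x1 : osnorm x <= 1.
  have xE : osnorm x =
      Num.max (osnorm (const_mx u : 'M_1)) (osnorm (const_mx v : 'M_1)).
    exact (osnorm_dsum (const_mx u : 'M_1) (const_mx v : 'M_1)).
  by rewrite xE ge_max u1.
(* The 2 x 2 matrix is seen as a 1 x 1 block matrix, of size \sum_(k < 1) 2,
   and the scalar factors have to be reindexed accordingly. *)
pose a := \mxcol_(k < 1) (1%:M : 'M[R[i]]_2).
pose b := \mxrow_(k < 1) B.
have a1 : opnorm a <= 1.
  apply: opnorm_le => // w; rewrite mul1r /a mxcol_mul.
  apply: hnorm_le; first exact: hnorm_ge0.
  by rewrite -hnorm_sqr hnorm_mxcol big_ord1 mul1mx.
have b1 : opnorm b <= r.
  apply: opnorm_le => // w; rewrite -(submxcolK w) mul_mxrow_mxcol big_ord1.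
  have -> : hnorm (\mxcol_j submxcol w j) = hnorm (submxcol w 0).
    apply/eqP; rewrite -(@eqrXn2 _ 2) ?hnorm_ge0//.
    by rewrite hnorm_mxcol big_ord1.
  by rewrite (le_trans (opnorm_ub _ _))// ler_wpM2r ?hnorm_ge0.
have xE k l : x k l = if k == l then (if k == 0 then u else v) else 0.
  rewrite /x; case: (split_ordP k) => k' ->; case: (split_ordP l) => l' ->;
    by rewrite ?block_mxEul ?block_mxEur ?block_mxEdl ?block_mxEdr mxE !ord1.
rewrite /M2_norm (_ : \mxblock_(k, l) _ = mxact a x b); last first.
  apply/matrixP => i j; rewrite !mxE (bigD1 (tagnat.sig2 i))//=.
  rewrite [X in _ = _ + X]big1 ?addr0 => [|k /negPf ki]; last first.
    by apply: big1 => l _; rewrite !mxE eq_sym ki mul0r scale0r.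
  rewrite (bigD1 (tagnat.sig2 i))//=.
  rewrite [X in _ = _ + X]big1 ?addr0 => [|l /negPf li]; last first.
    by rewrite xE eq_sym li scaler0.
  rewrite xE !mxE !eqxx mul1r.
  by case: (tagnat.sig2 j == 0); case: (tagnat.sig2 i == 0); rewrite ?scale0r.
apply: le_trans (osnorm_act _ _ _) _.
rewrite -[leRHS]mul1r ler_pM ?mulr_ge0 ?opnorm_ge0 ?osnorm_ge0//.
by rewrite -[1]mul1r ler_pM ?opnorm_ge0 ?osnorm_ge0.
Qed.

(** The range and the kernel of $P$ are in a position at least as orthogonal as
two summands of an $\ell_2$-sum. *)
Lemma left_M_projection_norm (R : realType) (Z : operatorSpaceType R)
    (P : {linear Z -> Z}) (s t : R[i]) (u v : Z) :
  complete_left_M_projection P -> P u = u -> P v = 0 ->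
  `|u| <= 1 -> `|v| <= 1 ->
  osnorm (const_mx (s *: u + t *: v) : 'M_1) <=
  Num.sqrt (cabs s ^+ 2 + cabs t ^+ 2).
Proof.
move=> [_ Piso] Pu Pv u1 v1.
rewrite -Piso map_const_mx linearD !linearZ /= Pu Pv scaler0 addr0.
by rewrite addrC addKr; exact: M2_norm_column.
Qed.

(** The inequality says that the norm of $f$ is its supremum over the unit ball
of $A$; without a supremum there is no boundedness or non-emptiness to check. *)
Definition norming (R : realType) (X : operatorSpaceType R) (A : set X)
    (f : dual X) : Prop :=
  forall M : R, (forall x, A x -> `|x| <= 1 -> cabs (f x) <= M) ->
    dual_norm f <= M.

(** Testing $f$ on $\overline{f(u)}\, u + \overline{f(v)}\, v$ gives
$|f(u)|^2 + |f(v)|^2 \le \|f\|^2$ for $u$ in the range of $P$; if $|f(u)|$ comes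
arbitrarily close to $\|f\|$, there is no room left for $f(v)$. *)
Lemma norming_range_vanishes (R : realType) (Z : operatorSpaceType R)
    (P : {linear Z -> Z}) (f : dual Z) (v : Z) :
  complete_left_M_projection P -> norming (range P) f -> P v = 0 -> f v = 0.
Proof.
move=> PM nf.
wlog v1 : v / `|v| <= 1 => [h|] Pv.
  have [->|v0] := eqVneq v 0; first exact: linear0.
  have := h (`|v|^-1 *: v); rewrite !linearZ /= Pv scaler0.
  rewrite normrZ normfV normr_id mulVf ?normr_eq0// => /(_ (lexx _) erefl).
  by move/eqP; rewrite scaler_eq0 invr_eq0 normr_eq0 (negPf v0) => /eqP.
set c := cabs (f v); set K := dual_norm f.
have K0 : 0 <= K by exact: dual_norm_ge0.
have key u : range P u -> `|u| <= 1 -> cabs (f u) ^+ 2 + c ^+ 2 <= K ^+ 2.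
  move=> [w _ wu] u1; have Pu : P u = u by rewrite -wu PM.1.
  set q := _ + _.
  have q0 : 0 <= q by rewrite addr_ge0 ?sqr_ge0.
  have : cabs (f ((f u)^*%C *: u + (f v)^*%C *: v)) <= K * Num.sqrt q.
    apply: le_trans (dual_norm_ub _ _) _; rewrite ler_wpM2l//.
    have := left_M_projection_norm (f u)^*%C (f v)^*%C PM Pu Pv u1 v1.
    by rewrite !cabs_conj.
  have -> : cabs (f ((f u)^*%C *: u + (f v)^*%C *: v)) = q.
    rewrite linearD !linearZ /= -[X in cabs X]/((f u)^*%C * f u + (f v)^*%C * f v).
    by rewrite !mulc_conj -rmorphD cabsC ger0_norm.
  have [->|qn0] := eqVneq q 0; first by rewrite sqr_ge0.
  have qp : 0 < Num.sqrt q by rewrite sqrtr_gt0 lt_neqAle eq_sym qn0.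
  rewrite -{1}(sqr_sqrtr q0) expr2 ler_pM2r// => qK.
  by rewrite -(sqr_sqrtr q0) ler_pXn2r ?nnegrE ?sqrtr_ge0.
have c2K : c ^+ 2 <= K ^+ 2.
  have := key 0; rewrite linear0 cabs0 expr0n /= add0r; apply.
    by exists 0 => //; exact: linear0.
  by rewrite normr0 ler01.
have : K <= Num.sqrt (K ^+ 2 - c ^+ 2).
  apply: nf => u Ru u1; rewrite -[leLHS]ger0_norm ?cabs_ge0// -sqrtr_sqr.
  by rewrite ler_wsqrtr// lerBrDr key.
rewrite -(@ler_pXn2r _ 2) ?nnegrE ?sqrtr_ge0//.
rewrite sqr_sqrtr ?subr_ge0// lerBrDr gerDl => c0.
by apply: cabs0_eq0; apply/eqP; rewrite -sqrf_eq0 eq_le c0 sqr_ge0.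
Qed.

Lemma dual_norm_bidual_embed (R : realType) (X : operatorSpaceType R) (x : X) :
  dual_norm (bidual_embed x) <= osnorm (const_mx x : 'M_1).
Proof.
apply: dual_norm_le => f f1; apply: le_trans (dual_norm_ub f x) _.
by rewrite ler_piMl ?osnorm_ge0// -osnorm_const_dual -osnorm_const_le1.
Qed.

(** Both functionals are killed by the kernel of the $M$-projection onto
$J^{\perp\perp}$, because elements of $J$ already norm them there; on
$J^{\perp\perp}$ itself they agree because their difference lies in
$J^\perp$. *)
Lemma right_M_ideal_unique_extension (R : realType) (Y : operatorSpaceType R)
    (J : set Y) (f g : dual Y) :
  right_M_ideal J -> norming J f -> norming J g ->
  (forall x, J x -> f x = g x) -> f = g.
Proof.
move=> [_ _ [P PM JP]] nf ng fg.
have vanish h (m : dual (dual Y)) : norming J h -> P m = 0 -> m h = 0.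
  move=> nh; apply: (@norming_range_vanishes _ _ P (bidual_embed h)) => // M hM.
  apply: le_trans (dual_norm_bidual_embed _) _; rewrite osnorm_const_dual.
  apply: nh => x Jx x1; apply: (hM (bidual_embed x)).
    by rewrite -JP => k; exact.
  rewrite osnorm_const_le1 osnorm_const_dual.
  by rewrite (le_trans (dual_norm_bidual_embed _))// -osnorm_const_le1.
have vanishB (m : dual (dual Y)) : P m = 0 -> m (f - g) = 0.
  by move=> Pm; rewrite linearB /= !vanish// subrr.
have mfg (m : dual (dual Y)) : m (f - g) = 0.
  have -> : m = P m + (m - P m) by rewrite addrC subrK.
  have Pm0 : P (m - P m) = 0 by rewrite linearB /= PM.1 subrr.
  rewrite dualDE (vanishB _ Pm0) addr0.
  have : annihilator (annihilator J) (P m) by rewrite JP; exists m.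
  by apply=> x Jx; rewrite -[LHS]/(f x - g x) fg ?subrr.
apply/eqP; rewrite -subr_eq0; apply/eqP/val_inj/funext => y.
exact: (mfg (bidual_embed y)).
Qed.

(** The adjoint of a complete contraction is well defined and contractive. The
new functional is only characterized by its values, which hides the proof of
continuity packed in it. *)
Lemma dual_comp (R : realType) (X Y : operatorSpaceType R) (T : {linear X -> Y})
    (g : dual Y) :
  completely_contractive T ->
  exists2 h : dual X, forall x, h x = g (T x) & dual_norm h <= dual_norm g.
Proof.
move=> T1.
have gT x : cabs (g (T x)) <= dual_norm g * osnorm (const_mx x : 'M_1).
  apply: le_trans (dual_norm_ub _ _) _; rewrite ler_wpM2l ?dual_norm_ge0//.
  by rewrite -(map_const_mx T).
have gTP : (g \o T : X -> R[i]^o) \in @dual_pred R X.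
  apply/asboolP; split; first by move=> a x y; rewrite /= !linearP.
  apply: (@bounded_linear_continuous _ _ _ (g \o T)).
  apply/linear_boundedP; exists (dual_norm g)%:C; split.
    by rewrite realE lecR dual_norm_ge0.
  move=> r gr x; apply: le_trans (ler_wpM2r (normr_ge0 x) (ltW gr)).
  by have := gT x; rewrite -lecR rmorphM /= -osnorm1.
exists (Dual gTP) => //; apply: dual_norm_le => x x1.
by apply: le_trans (gT x) _; rewrite ler_piMr ?dual_norm_ge0// -osnorm_const_le1.
Qed.

(** An extension of $f$ from $X$ to $X^{**}$ that does not increase the norm has
its norm already on $X$. *)
Lemma norming_range_bidual_embed (R : realType) (X : operatorSpaceType R)
    (f : dual X) (h : dual (dual (dual X))) :
  dual_norm h <= dual_norm f -> (forall x, h (bidual_embed x) = f x) ->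
  norming (range (@bidual_embed R X)) h.
Proof.
move=> hf hE M hM; apply: le_trans hf _; apply: dual_norm_le => x x1.
rewrite -hE; apply: hM; first by exists x.
rewrite osnorm_const_le1 osnorm_const_dual.
by rewrite (le_trans (dual_norm_bidual_embed _))// -osnorm_const_le1.
Qed.

Theorem corollary3p7 (R : realType) (X : operatorSpaceType R) :
  ~ reflexive_space X -> right_M_embedded X -> unique_extension_property X.
Proof.
move=> _ XM T T1 Ti y; apply/val_inj/funext => f /=.
have f1 : dual_norm (bidual_embed f) <= dual_norm f.
  by rewrite (le_trans (dual_norm_bidual_embed _))// osnorm_const_dual.
have [h hE hf] := dual_comp (bidual_embed f) T1.
rewrite -[LHS]/(bidual_embed f (T y)) -hE -[RHS]/(bidual_embed f y).
have hi x : h (bidual_embed x) = f x by rewrite hE Ti.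
suff -> : h = bidual_embed f by [].
apply: (right_M_ideal_unique_extension XM).
- exact: norming_range_bidual_embed (le_trans hf f1) hi.
- exact: norming_range_bidual_embed f1 _.
- by move=> _ [x _ <-]; rewrite hi.
Qed.
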